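(* Let $f,g_1,\dots,g_m,h_1,\dots,h_l\in\mathbb{R}[\mathbf{x}]$, $g=\{g_i\}_{i\in[m]}$, $h=\{h_j\}_{j\in[l]}$, and consider the polynomial optimization problem (POP) of minimizing $f$ over $S(g)\cap V(h)$. 1. For every integer $k\ge k_{\min}$ the following conditions are equivalent: (a) $(0,\infty)\subseteq Q_k^\circ(g)+I_k(h)$; (b) $\delta\in Q_k^\circ(g)+I_k(h)$ for every $\delta>0$; (c) $1\in Q_k^\circ(g)+I_k(h)$. If these conditions hold for all integers $k\ge k_{\min}$, then the POP has the constant trace property (CTP). 2. Assume that $h=\emptyset$ and that $S(g)$ has nonempty interior. Then the POP has CTP if and only if $(0,\infty)\subseteq Q_k^\circ(g)$ for every integer $k\ge k_{\min}$.
   Context: $\mathbf{x}=(x_1,\dots,x_n)$; $\mathbb{R}[\mathbf{x}]_d$ denotes polynomials of degree at most $d$, $\Sigma[\mathbf{x}]_d$ sums of squares of polynomials of degree at most $d$. For $p\in\mathbb{R}[\mathbf{x}]$, $\lceil p\rceil:=\lceil \deg(p)/2\rceil$. $\mathbb{N}^n_d:=\{\alpha\in\mathbb{N}^n:|\alpha|\le d\}$, $s(d):=\binom{n+d}{n}$, and $\mathbf{v}_d(\mathbf{x})=(\mathbf{x}^\alpha)_{\alpha\in\mathbb{N}^n_d}$ is the vector of monomials of degree at most $d$ (graded lexicographic order). $S(g):=\{\mathbf{x}\in\mathbb{R}^n: g_i(\mathbf{x})\ge0,\ i\in[m]\}$, $V(h):=\{\mathbf{x}\in\mathbb{R}^n:h_j(\mathbf{x})=0,\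 j\in[l]\}$. $k_{\min}:=\max\{\lceil f\rceil,\lceil g_i\rceil\ (i\in[m]),\lceil h_j\rceil\ (j\in[l])\}$. $Q_k^\circ(g):=\{\mathbf{v}_k^\top\mathbf{G}_0\mathbf{v}_k+\sum_{i\in[m]}g_i\mathbf{v}_{k-\lceil g_i\rceil}^\top\mathbf{G}_i\mathbf{v}_{k-\lceil g_i\rceil}:\ \mathbf{G}_i \text{ real symmetric positive definite},\ i\in\{0\}\cup[m]\}$ (interior of the truncated quadratic module). $I_k(h):=\{\sum_{j\in[l]}\psi_jh_j:\ \psi_j\in\mathbb{R}[\mathbf{x}]_{2(k-\lceil h_j\rceil)}\}$ (with $I_k(\emptyset)=\{0\}$). For $\mathbf{y}=(y_\alpha)_{\alpha\in\mathbb{N}^n_{2k}}$: the moment matrix $\mathbf{M}_d(\mathbf{y})=(y_{\alpha+\beta})_{\alpha,\beta\in\mathbb{N}^n_d}$ and, for $q=\sum_\gamma q_\gamma\mathbf{x}^\gamma$, the localizing matrix $\mathbf{M}_d(q\,\mathbf{y})=(\sum_\gamma q_\gamma y_{\alpha+\beta+\gamma})_{\alpha,\beta\in\mathbb{N}^n_d}$. $\mathcal{S}_k$ is the set of real symmetric block-diagonal matrices $\mathrm{diag}(\mathbf{X}_0,\dots,\mathbf{X}_m)$ with $\mathbf{X}_0$ of size $s(k)$ and $\mathbf{X}_i$ of size $s(k-\lceil g_i\rceil)$; $\mathbf{D}_k(\mathbf{y}):=\mathrm{diag}(\mathbf{M}_k(\mathbf{y}),\mathbf{M}_{k-\lceil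 g_1\rceil}(g_1\mathbf{y}),\dots,\mathbf{M}_{k-\lceil g_m\rceil}(g_m\mathbf{y}))\in\mathcal{S}_k$. CTP: the POP has CTP if for every integer $k\ge k_{\min}$ there exist $a_k>0$ and a positive definite $\mathbf{P}_k\in\mathcal{S}_k$ such that every $\mathbf{y}\in\mathbb{R}^{s(2k)}$ with $\mathbf{M}_{k-\lceil h_j\rceil}(h_j\mathbf{y})=0$ for all $j\in[l]$ and $y_{\mathbf{0}}=1$ satisfies $\mathrm{trace}(\mathbf{P}_k\mathbf{D}_k(\mathbf{y})\mathbf{P}_k)=a_k$. *)

(* Defs.v *)
From HB Require Import structures.
From mathcomp Require Import all_boot all_order all_algebra.
From mathcomp Require Import reals.
From mathcomp Require Import mpoly.
Set Implicit Arguments. Unset Strict Implicit. Unset Printing Implicit Defensive.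
Import Order.TTheory GRing.Theory Num.Theory.
Local Open Scope ring_scope.

Section POP.
Variables (R : realType) (n : nat).

Definition hdeg (p : {mpoly R[n]}) : nat := uphalf (msize p).-1.

Definition symPD (T : finType) (G : T -> T -> R) : Prop :=
  (forall a b, G a b = G b a) /\
  (forall z : T -> R, (exists a, z a != 0) ->
      0 < \sum_(a : T) \sum_(b : T) z a * G a b * z b).

Definition gram_poly (d : nat) (G : 'X_{1..n < d.+1} -> 'X_{1..n < d.+1} -> R)
  : {mpoly R[n]} :=
  \sum_(a : 'X_{1..n < d.+1}) \sum_(b : 'X_{1..n < d.+1})
     G a b *: 'X_[(a : 'X_{1..n}) + b].

Definition inQint (m : nat) (g : 'I_m -> {mpoly R[n]}) (k : nat)
    (p : {mpoly R[n]}) : Prop :=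
  exists G0 : 'X_{1..n < k.+1} -> 'X_{1..n < k.+1} -> R,
  exists G : forall i : 'I_m,
      'X_{1..n < (k - hdeg (g i)).+1} -> 'X_{1..n < (k - hdeg (g i)).+1} -> R,
    symPD G0 /\ (forall i, symPD (G i)) /\
    p = gram_poly G0 + \sum_(i < m) g i * gram_poly (G i).

Definition inIk (l : nat) (h : 'I_l -> {mpoly R[n]}) (k : nat)
    (p : {mpoly R[n]}) : Prop :=
  exists psi : 'I_l -> {mpoly R[n]},
    (forall j, (msize (psi j) <= (2 * (k - hdeg (h j))).+1)%N) /\
    p = \sum_(j < l) psi j * h j.

Definition inQI m (g : 'I_m -> {mpoly R[n]}) l (h : 'I_l -> {mpoly R[n]})
    (k : nat) (p : {mpoly R[n]}) : Prop :=
  exists q r, inQint g k q /\ inIk h k r /\ p = q + r.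

Definition kmin (f : {mpoly R[n]}) m (g : 'I_m -> {mpoly R[n]})
    l (h : 'I_l -> {mpoly R[n]}) : nat :=
  maxn (hdeg f) (maxn (\max_(i < m) hdeg (g i)) (\max_(j < l) hdeg (h j))).

Definition loc_entry (q : {mpoly R[n]}) (y : 'X_{1..n} -> R)
    (a b : 'X_{1..n}) : R :=
  \sum_(c <- msupp q) q@_c * y (a + b + c)%MM.

Definition mom_entry (y : 'X_{1..n} -> R) (a b : 'X_{1..n}) : R := y (a + b)%MM.

(* index set of the block-diagonal space S_k: block None has size s(k),
   block Some i has size s(k - ceil g_i) *)
Definition blk_bound m (g : 'I_m -> {mpoly R[n]}) (k : nat) (i : option 'I_m) : nat :=
  if i is Some i' then (k - hdeg (g i')).+1 else k.+1.

Definition blk m (g : 'I_m -> {mpoly R[n]}) (k : nat) : finType :=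
  {i : option 'I_m & 'X_{1..n < blk_bound g k i}}.

Definition blockdiag m (g : 'I_m -> {mpoly R[n]}) k (X : blk g k -> blk g k -> R) : Prop :=
  forall u v : blk g k, tag u != tag v -> X u v = 0.

Definition Dk m (g : 'I_m -> {mpoly R[n]}) k (y : 'X_{1..n} -> R)
    (u v : blk g k) : R :=
  if tag u == tag v then
    match tag u with
    | None => mom_entry y (tagged u : 'X_{1..n}) (tagged v : 'X_{1..n})
    | Some i => loc_entry (g i) y (tagged u : 'X_{1..n}) (tagged v : 'X_{1..n})
    end
  else 0.

Definition trPDP (T : finType) (P D : T -> T -> R) : R :=
  \sum_(u : T) \sum_(v : T) \sum_(w : T) P u v * D v w * P w u.

Definition CTP (f : {mpoly R[n]}) m (g : 'I_m -> {mpoly R[n]})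
    l (h : 'I_l -> {mpoly R[n]}) : Prop :=
  forall k : nat, (kmin f g h <= k)%N ->
  exists a : R, 0 < a /\
  exists P : blk g k -> blk g k -> R,
    blockdiag P /\ symPD P /\
    forall y : 'X_{1..n} -> R,
      (forall j (a b : 'X_{1..n < (k - hdeg (h j)).+1}),
          loc_entry (h j) y a b = 0) ->
      y 0%MM = 1 ->
      trPDP P (@Dk m g k y) = a.

Definition S_nonempty_interior m (g : 'I_m -> {mpoly R[n]}) : Prop :=
  exists (x : 'I_n -> R) (e : R), 0 < e /\
    forall z : 'I_n -> R, (forall t, `|z t - x t| < e) ->
      forall i, 0 <= (g i).@[z].

End POP.

(* Main.v *)
(* Let L_y be the Riesz functional of y (x^c |-> y_c).  For P in S_k one has
   trace (P D_k(y) P) = L_y (q_P), where q_P is the weighted sum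
   sum_i g_i v^T G_i v (g_0 = 1) whose Gram matrices G_i are the diagonal blocks
   of P^2, and L_y kills I_k(h) as soon as the localizing matrices of the h_j
   vanish.  If 1 = q + r with q in the interior of Q_k(g) and r in I_k(h), take
   for P the block-diagonal square root of the Gram matrices of q: the trace is
   then L_y (1 - r) = 1.  Conversely, without equality constraints, constancy of
   L_y (q_P) on all y with y_0 = 1 forces the polynomial q_P to be the constant
   a_k, and one rescales. *)
Require Import Defs.
From HB Require Import structures.
From mathcomp Require Import all_boot all_order all_algebra.
From mathcomp Require Import reals complex.
From mathcomp Require Import mpoly.
Import Order.TTheory GRing.Theory Num.Theory.
Local Open Scope ring_scope.

(** * Square roots of positive definite matrices *)

(** Newton interpolation: a multiple of the product of the ['X - b%:P] over the earlier nodes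
    corrects the value at a new node without changing the others. *)
Lemma poly_interpolation {F : fieldType} (s : seq F) (f : F -> F) :
  exists p : {poly F}, {in s, forall x, p.[x] = f x}.
Proof.
elim: s => [|a s [p pE]]; first by exists 0.
have [a_s|aNs] := boolP (a \in s).
  by exists p => x /predU1P[->|]; apply: pE.
pose w := \prod_(b <- s) ('X - b%:P).
have wa0 : w.[a] != 0 by rewrite -[_ == 0]/(root w a) root_prod_XsubC.
exists (p + ((f a - p.[a]) / w.[a]) *: w) => x.
rewrite hornerD hornerZ => /predU1P[->|xs]; first by rewrite divfK // subrKC.
have /rootP -> : root w x by rewrite root_prod_XsubC.
by rewrite mulr0 addr0 pE.
Qed.

Lemma tr_horner_mx {F : comNzRingType} {n : nat} (A : 'M[F]_n.+1) (p : {poly F}) :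
  (horner_mx A p)^T = horner_mx A^T p.
Proof.
elim/poly_ind: p => [|p c IHp]; first by rewrite !rmorph0 trmx0.
rewrite !rmorphD !rmorphM /= !horner_mx_X !horner_mx_C raddfD /= tr_scalar_mx.
rewrite trmx_mul IHp; congr (_ + _).
exact/esym/comm_horner_mx.
Qed.

Lemma horner_mx_diagonalized {F : fieldType} {n : nat} (A S : 'M[F]_n.+1)
    (d : 'rV[F]_n.+1) (p : {poly F}) :
    S \in unitmx -> A = invmx S *m diag_mx d *m S ->
  (forall i, p.[d 0 i] = d 0 i) -> horner_mx A p = A.
Proof.
move=> Sunit -> pd; rewrite horner_mx_uconjC // horner_mx_diag.
by congr (_ *m diag_mx _ *m _); apply/rowP => i; rewrite mxE pd.
Qed.

Lemma sqr_cV_ge0 {R : realDomainType} {n : nat} {v : 'cV[R]_n} :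
  0 <= (v^T *m v) 0 0.
Proof.
by rewrite mxE sumr_ge0 // => i _; rewrite mxE -expr2 sqr_ge0.
Qed.

Lemma sqr_cV_gt0 {R : realDomainType} {n : nat} {v : 'cV[R]_n} :
  v != 0 -> 0 < (v^T *m v) 0 0.
Proof.
move=> v0; rewrite lt_def sqr_cV_ge0 andbT; apply: contra v0 => /eqP.
rewrite mxE => /eqP; rewrite psumr_eq0; last first.
  by move=> i _; rewrite mxE -expr2 sqr_ge0.
move=> /allP v0; apply/eqP/colP => i; rewrite mxE.
by have := v0 i (mem_index_enum _); rewrite mxE /= -expr2 sqrf_eq0 => /eqP.
Qed.

(* Diagonalizing A over R[i], its eigenvalues are positive reals; for a real
   polynomial q taking the value x^(1/4) at each eigenvalue x, C = q(A) is real
   symmetric with C^4 = A, so C^2 is a square root of A which is positive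
   definite because v^T C^2 v = |C v|^2. *)
Lemma posdef_mx_sqrt_S {R : rcfType} {n : nat} (A : 'M[R]_n.+1) :
    A^T = A -> (forall v : 'cV_n.+1, v != 0 -> 0 < (v^T *m A *m v) 0 0) ->
  exists B : 'M[R]_n.+1, [/\ B^T = B, B *m B = A &
    forall v : 'cV_n.+1, v != 0 -> 0 < (v^T *m B *m v) 0 0].
Proof.
move=> Asym Apos.
pose AC := map_mx (real_complex R) A.
pose S := spectralmx AC; pose d := spectral_diag AC.
have AC_herm : AC \is hermsymmx.
  apply: realsym_hermsym.
    apply/is_hermitianmxP; rewrite /AC expr0 scale1r.
    by apply/matrixP => i j; rewrite -[in LHS]Asym !mxE.
  by apply/mxOverP => i j; rewrite mxE complex_real.
have Sunit : S \in unitmx := spectral_unit AC.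
have AC_eq : AC = invmx S *m diag_mx d *m S.
  exact/orthomx_spectralP/hermitian_normalmx.
have d_real i : d 0 i = real_complex R (complex.Re (d 0 i)).
  have /mxOverP d_real := hermitian_spectral_diag_real AC_herm.
  by rewrite RRe_real.
have d_gt0 i : 0 < complex.Re (d 0 i).
  (* Row [i] of [S] is a left eigenvector because [S AC = diag(d) S]; it is nonzero, as a zero row
     would make the determinant of [S] vanish. *)
  have : eigenvalue AC (d 0 i).
    apply/eigenvalueP; exists (row i S).
      rewrite -row_mul AC_eq -mulmxA mulKVmx // row_mul row_diag_mx.
      by rewrite -scalemxAl -rowE.
    apply: contraTneq Sunit => Si0; rewrite unitmxE (expand_det_row S i).
    rewrite big1 ?unitr0 // => j _.
    by move/rowP/(_ j): Si0; rewrite !mxE => ->; rewrite mul0r.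
  (* The eigenvalue is the image of a real number, so being a root of the characteristic polynomial
     descends to [A]. This gives a real row eigenvector [v], and [v A v^T > 0] forces the eigenvalue
     to be positive. *)
  rewrite d_real eigenvalue_root_char -map_char_poly fmorph_root.
  rewrite -eigenvalue_root_char => /eigenvalueP[v vA v0].
  have vT0 : v^T != 0 by rewrite trmx_eq0.
  have := Apos _ vT0; rewrite trmxK vA -scalemxAl mxE pmulr_lgt0 //.
  by have := sqr_cV_gt0 vT0; rewrite trmxK.
have [q qE] := poly_interpolation [seq complex.Re (d 0 i) | i : 'I_n.+1]
                 (Num.sqrt \o Num.sqrt).
pose C := horner_mx A q.
have Csym : C^T = C by rewrite tr_horner_mx Asym.
have C4 : (C *m C) *m (C *m C) = A.
  apply: (@map_mx_inj _ _ (real_complex R)).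
  have -> : (C *m C) *m (C *m C) = horner_mx A (q ^+ 4).
    by rewrite rmorphXn /= !exprS expr0 mulr1 !mulrA /C !mulmxA.
  rewrite map_horner_mx; apply: horner_mx_diagonalized Sunit AC_eq _ => i.
  rewrite d_real horner_map horner_exp qE ?image_f //=.
  by rewrite -[4%N]/(2 * 2)%N exprM !sqr_sqrtr ?sqrtr_ge0 ?ltW.
exists (C *m C); split => // [|v v0]; first by rewrite trmx_mul Csym.
have Cv0 : C *m v != 0.
  apply: contraTneq (Apos v v0) => Cv0.
  by rewrite -C4 -!mulmxA Cv0 !mulmx0 mxE ltxx.
by rewrite mulmxA -mulmxA -[v^T *m C]trmxK trmx_mul trmxK Csym sqr_cV_gt0.
Qed.

Lemma posdef_mx_sqrt {R : rcfType} {n : nat} (A : 'M[R]_n) :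
    A^T = A -> (forall v : 'cV_n, v != 0 -> 0 < (v^T *m A *m v) 0 0) ->
  exists B : 'M[R]_n, [/\ B^T = B, B *m B = A &
    forall v : 'cV_n, v != 0 -> 0 < (v^T *m B *m v) 0 0].
Proof.
(* Size 0 is treated apart because [horner_mx] needs the ring of matrices of nonzero size. *)
case: n A => [|n] A; last exact: posdef_mx_sqrt_S.
by move=> _ Apos; exists A; split=> //; rewrite !flatmx0.
Qed.

(** Passes from families indexed by a finite type, as in [symPD], to genuine matrices, where the
    spectral theorem is available. *)
Lemma qform_enum {R : realType} {T : finType} (M : T -> T -> R) (z : T -> R) :
  let v := \col_(i < #|T|) z (enum_val i) in
  \sum_(a : T) \sum_(b : T) z a * M a b * z b
  = (v^T *m (\matrix_(i, j) M (enum_val i) (enum_val j)) *m v) 0 0.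
Proof.
move=> v; rewrite mxE exchange_big /= big_enum_val; apply: eq_bigr => j _ /=.
rewrite !mxE big_enum_val big_distrl; apply: eq_bigr => i _ /=.
by rewrite !mxE.
Qed.

Lemma symPD_sqrt {R : realType} {T : finType} {G : T -> T -> R} :
  symPD G -> exists P : T -> T -> R,
    symPD P /\ forall a b, \sum_(c : T) P a c * P c b = G a b.
Proof.
move=> [Gsym Gpos].
pose A := \matrix_(i < #|T|, j < #|T|) G (enum_val i) (enum_val j).
have Asym : A^T = A by apply/matrixP => i j; rewrite !mxE Gsym.
have colE (v : 'cV[R]_#|T|) : v = \col_i v (enum_rank (enum_val i)) 0.
  by apply/colP => i; rewrite mxE enum_valK.
have [|B [Bsym BB Bpos]] := posdef_mx_sqrt _ Asym.
  move=> v v0; rewrite [v]colE -(qform_enum G (fun a => v (enum_rank a) 0)).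
  apply: Gpos; have [i vi0] : exists i, v i 0 != 0.
    apply/existsP; apply: contraNT v0 => /existsPn v0; apply/eqP/colP => i.
    by rewrite mxE; apply/eqP; have := v0 i; rewrite negbK.
  by exists (enum_val i); rewrite enum_valK.
pose P a b := B (enum_rank a) (enum_rank b).
have PE : \matrix_(i, j) P (enum_val i) (enum_val j) = B.
  by apply/matrixP => i j; rewrite mxE /P !enum_valK.
exists P; split; first split.
- by move=> a b; rewrite /P -[in LHS]Bsym mxE.
- move=> z [a za0]; rewrite qform_enum PE; apply: Bpos.
  apply: contraNneq za0 => /colP/(_ (enum_rank a)).
  by rewrite !mxE enum_rankK => ->.
- move=> a b; have /matrixP/(_ (enum_rank a) (enum_rank b)) := BB.
  rewrite !mxE !enum_rankK => <-; rewrite big_enum_val /=.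
  by apply: eq_bigr => i _; rewrite /P enum_valK.
Qed.

(** * Squares and principal submatrices of positive definite matrices *)

(** The form of [P^2] at [z] is [|P z|^2]. If it vanished, then [P z = 0], against positivity of the
    form of [P] at [z]. *)
Lemma symPD_sqr {R : realType} {T : finType} {P : T -> T -> R} :
  symPD P -> symPD (fun a b => \sum_(c : T) P a c * P c b).
Proof.
move=> [Psym Ppos]; split=> [a b|z z_neq0].
  by apply: eq_bigr => c _; rewrite mulrC (Psym c) (Psym a).
have -> : \sum_a \sum_b z a * (\sum_c P a c * P c b) * z b
          = \sum_c (\sum_a z a * P a c) ^+ 2.
  under [RHS]eq_bigr => c _ do rewrite expr2 big_distrlr /=.
  rewrite [RHS]exchange_big; apply: eq_bigr => a _ /=.
  rewrite [RHS]exchange_big; apply: eq_bigr => b _ /=.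
  rewrite big_distrr big_distrl; apply: eq_bigr => c _ /=.
  by rewrite (Psym c b) !mulrA mulrAC.
rewrite lt_def sumr_ge0 ?andbT => [|c _]; last exact: sqr_ge0.
apply: contraL (Ppos z z_neq0) => /eqP /psumr_eq0P zP0; rewrite -leNgt.
rewrite exchange_big /= big1 // => c _; rewrite -big_distrl /=.
have /eqP := zP0 (fun c _ => sqr_ge0 _) c isT.
by rewrite sqrf_eq0 => /eqP ->; rewrite mul0r.
Qed.

Lemma sum_fiberM {R : realType} {S T : finType} (f : S -> T) (z : S -> R)
    (X : T -> R) :
  \sum_(u : T) (\sum_(a | f a == u) z a) * X u = \sum_(a : S) z a * X (f a).
Proof.
rewrite [RHS](partition_big f xpredT) //=; apply: eq_bigr => u _.
by rewrite big_distrl; apply: eq_bigr => a /eqP ->.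
Qed.

(** The restricted form at [z] is the form of [A] at the pushforward of [z] along [f], which is
    nonzero because the fibres of an injective [f] have at most one element. *)
Lemma symPD_restrict {R : realType} {S T : finType} {f : S -> T}
    {A : T -> T -> R} :
  injective f -> symPD A -> symPD (fun a b => A (f a) (f b)).
Proof.
move=> f_inj [Asym Apos]; split=> [a b|z [a0 za0]]; first exact: Asym.
have := Apos (fun u => \sum_(a | f a == u) z a).
have -> : \sum_u \sum_v (\sum_(a | f a == u) z a) * A u v *
            (\sum_(b | f b == v) z b) = \sum_a \sum_b z a * A (f a) (f b) * z b.
  under eq_bigr => u _.
    under eq_bigr => v _ do rewrite -mulrA.
    rewrite -big_distrr /=; over.
  rewrite (sum_fiberM _ _ (fun u => \sum_v A u v * _)).
  apply: eq_bigr => a _; rewrite big_distrr /=.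
  under eq_bigr => v _ do rewrite mulrA mulrC.
  by rewrite sum_fiberM; apply: eq_bigr => b _; rewrite mulrC.
apply; exists (f a0); rewrite (big_pred1 a0) // => a.
by rewrite (inj_eq f_inj).
Qed.

(** * Direct sums of matrices over a tagged index type *)

Lemma sum_tagged {R : realType} {I : finType} {T : I -> finType}
    (F : {i : I & T i} -> R) :
  \sum_u F u = \sum_(i : I) \sum_(a : T i) F (Tagged T a).
Proof.
by rewrite (sig_big_dep _ _ (fun i a => F (Tagged T a))); apply: eq_bigr => -[].
Qed.

(** [tagged_as u v] casts the index of [v] into the block of [u]; the test on tags ensures that it
    is read only when the cast is meaningful. *)
Definition block_sum {R : realType} {I : finType} {T : I -> finType}
    (A : forall i, T i -> T i -> R) (u v : {i : I & T i}) : R :=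
  if tag u == tag v then A (tag u) (tagged u) (tagged_as u v) else 0.

Lemma block_sum_diag {R : realType} {I : finType} {T : I -> finType}
    (A : forall i, T i -> T i -> R) (i : I) (a b : T i) :
  block_sum A (Tagged T a) (Tagged T b) = A i a b.
Proof. by rewrite /block_sum eqxx tagged_asE. Qed.

Lemma block_sum_off {R : realType} {I : finType} {T : I -> finType}
    (A : forall i, T i -> T i -> R) (u v : {i : I & T i}) :
  tag u != tag v -> block_sum A u v = 0.
Proof. by rewrite /block_sum => /negPf ->. Qed.

Lemma sum_tagged_block {R : realType} {I : finType} {T : I -> finType} (i : I)
    (F : {i : I & T i} -> R) :
  (forall u, tag u != i -> F u = 0) ->
  \sum_u F u = \sum_(a : T i) F (Tagged T a).
Proof.
move=> F0; rewrite sum_tagged (bigD1 i) //= [X in _ + X]big1 ?addr0 // => j ji.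
by rewrite big1 // => a _; apply: F0.
Qed.

Lemma sum_block_sum {R : realType} {I : finType} {T : I -> finType}
    (Q : {i : I & T i} -> {i : I & T i} -> R) (A : forall i, T i -> T i -> R) :
  \sum_u \sum_v Q u v * block_sum A u v
  = \sum_i \sum_(a : T i) \sum_(b : T i)
      Q (Tagged T a) (Tagged T b) * A i a b.
Proof.
rewrite sum_tagged; apply: eq_bigr => i _; apply: eq_bigr => a _.
rewrite (sum_tagged_block i) => [|v vi].
  by apply: eq_bigr => b _; rewrite block_sum_diag.
by rewrite block_sum_off 1?eq_sym // mulr0.
Qed.

(** The quadratic form splits over the blocks: a block where [z] is nonzero contributes a positive
    term, all others a nonnegative one. *)
Lemma symPD_block_sum {R : realType} {I : finType} {T : I -> finType}
    (A : forall i, T i -> T i -> R) :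
  (forall i, symPD (A i)) -> symPD (block_sum A).
Proof.
move=> Apd; split=> [[i a] [j b]|z [[i a] za0]].
  have [ij|ij] := eqVneq i j; last by rewrite !block_sum_off // eq_sym.
  by case: j / ij b => b; rewrite !block_sum_diag (Apd i).1.
under eq_bigr => u _ do under eq_bigr => v _ do rewrite mulrAC.
rewrite (sum_block_sum (fun u v => z u * z v)).
under eq_bigr => j _ do under eq_bigr => b _ do
  under eq_bigr => c _ do rewrite mulrAC.
rewrite (bigD1 i) //= ltr_pwDl //.
  by apply: (Apd i).2; exists a.
apply: sumr_ge0 => j _.
(* [symPD] speaks only of nonzero vectors, so a block on which [z] vanishes is handled
   separately. *)
have [/existsP[b zb]|/existsPn z0] := boolP [exists b, z (Tagged T (b : T j)) != 0].
  by apply/ltW/((Apd j).2 (fun b => z (Tagged T b))); exists b.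
rewrite big1 // => b _; rewrite big1 // => c _.
by have := z0 b; rewrite negbK => /eqP ->; rewrite !mul0r.
Qed.

Lemma block_sum_sqr {R : realType} {I : finType} {T : I -> finType}
    (A : forall i, T i -> T i -> R) (i : I) (a b : T i) :
  \sum_u block_sum A (Tagged T a) u * block_sum A u (Tagged T b)
  = \sum_(c : T i) A i a c * A i c b.
Proof.
rewrite (sum_tagged_block i) => [|u ui].
  by apply: eq_bigr => c _; rewrite !block_sum_diag.
by rewrite [block_sum _ u _]block_sum_off // mulr0.
Qed.

(** * The Riesz functional of a moment sequence *)

Definition riesz {R : realType} {n : nat} (y : 'X_{1..n} -> R)
  (p : {mpoly R[n]}) : R := \sum_(c <- msupp p) p@_c * y c.

(** Frees the sum from the support of [p], so that several polynomials can be summed over one common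
    list; linearity rests on this. *)
Lemma riesz_seq {R : realType} {n : nat} (y : 'X_{1..n} -> R)
    (p : {mpoly R[n]}) (s : seq 'X_{1..n}) :
  uniq s -> {subset msupp p <= s} -> riesz y p = \sum_(c <- s) p@_c * y c.
Proof.
move=> s_uniq ps; rewrite (bigID (fun c => c \in msupp p)) /= [X in _ + X]big1 ?addr0.
  rewrite -big_filter; apply/perm_big/uniq_perm; rewrite ?filter_uniq //.
  by move=> c; rewrite mem_filter; apply/esym/andb_idr/ps.
by move=> c /memN_msupp_eq0 ->; rewrite mul0r.
Qed.

Lemma riesz_is_linear {R : realType} {n : nat} (y : 'X_{1..n} -> R) :
  GRing.linear_for *%R (riesz y).
Proof.
move=> a p q; pose s := undup (msupp p ++ msupp q).
have s_uniq : uniq s by apply: undup_uniq.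
have ps : {subset msupp p <= s}.
  by move=> c cp; rewrite mem_undup mem_cat cp.
have qs : {subset msupp q <= s}.
  by move=> c cq; rewrite mem_undup mem_cat cq orbT.
rewrite (riesz_seq y _ _ s_uniq ps) (riesz_seq y _ _ s_uniq qs).
rewrite (riesz_seq y _ _ s_uniq) => [|c /msuppD_le].
  rewrite big_distrr -big_split; apply: eq_bigr => c _ /=.
  by rewrite mcoeffD mcoeffZ mulrDl mulrA.
by rewrite mem_cat => /orP[/msuppZ_le /ps|/qs].
Qed.

HB.instance Definition _ (R : realType) (n : nat) (y : 'X_{1..n} -> R) :=
  GRing.isLinear.Build R {mpoly R[n]} R *%R (riesz y) (riesz_is_linear y).

Lemma rieszX {R : realType} {n : nat} (y : 'X_{1..n} -> R) (c : 'X_{1..n}) :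
  riesz y 'X_[c] = y c.
Proof. by rewrite /riesz msuppX big_seq1 mcoeffX eqxx mul1r. Qed.

Lemma riesz1 {R : realType} {n : nat} (y : 'X_{1..n} -> R) : riesz y 1 = y 0%MM.
Proof. by rewrite -mpolyX0 rieszX. Qed.

Lemma loc_entry_riesz {R : realType} {n : nat} (q : {mpoly R[n]})
    (y : 'X_{1..n} -> R) (a b : 'X_{1..n}) :
  loc_entry q y a b = riesz y ('X_[a + b] * q).
Proof.
rewrite [in RHS](mpolyE q) big_distrr linear_sum; apply: eq_bigr => c _ /=.
by rewrite -scalerAr -mpolyXD linearZ /= rieszX.
Qed.

(** * Splitting monomials, and vanishing on the truncated ideal *)

(** Induction on [t]: as long as [a] has smaller degree than [c], some coordinate of [a] lies
    strictly below that of [c] and can be raised by one. *)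
Lemma mnm_split_deg {n : nat} {c : 'X_{1..n}} {t : nat} :
  (t <= mdeg c)%N -> exists2 a, (a <= c)%MM & mdeg a = t.
Proof.
elim: t => [|t IHt] tc.
  by exists 0%MM; rewrite ?mdeg0 //; apply/mnm_lepP => i; rewrite mnm0E.
have [a ac at_] := IHt (ltnW tc).
have /existsP[i ai] : [exists i, a i < c i]%N.
  apply: contraLR tc => /existsPn ca; rewrite -leqNgt -at_ !mdegE.
  by apply: leq_sum => i _; rewrite leqNgt ca.
exists (a + U_(i))%MM; last by rewrite mdegD mdeg1 at_ addn1.
apply/mnm_lepP => j; rewrite mnmDE mnm1E.
by case: eqVneq => [<-|_]; rewrite ?addn1 // addn0; apply/mnm_lepP.
Qed.

(** Choosing a divisor of degree [min(|c|, d)] leaves a cofactor of degree at most [d]. Hence every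
    monomial of degree at most [2d] occurs in some entry of a moment matrix of order [d]. *)
Lemma mnm_split_half {n d : nat} (c : 'X_{1..n}) : (mdeg c <= 2 * d)%N ->
  exists a b : 'X_{1..n < d.+1}, c = (a + b)%MM.
Proof.
move=> cd; have [a ac a_deg] := mnm_split_deg (geq_minl (mdeg c) d).
have caK := submK ac.
have c_deg : (mdeg (c - a) + mdeg a = mdeg c)%N by rewrite -mdegD caK.
have aP : (mdeg a < d.+1)%N by rewrite ltnS a_deg geq_minr.
have bP : (mdeg (c - a) < d.+1)%N.
  rewrite ltnS -(leq_add2r (mdeg a)) c_deg a_deg.
  by case: (leqP (mdeg c) d) => [_|/ltnW _]; rewrite ?leq_addl // addnn -mul2n.
by exists (BMultinom bP), (BMultinom aP); rewrite /= caK.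
Qed.

(** Each monomial of [psi j] splits as [x^(a+b)] within the range of the localizing matrix of [h j],
    and the functional at [x^(a+b) h_j] is the entry [(a, b)] of that matrix. *)
Lemma riesz_inIk {R : realType} {n l : nat} {h : 'I_l -> {mpoly R[n]}} {k : nat}
    {y : 'X_{1..n} -> R} {r : {mpoly R[n]}} :
    (forall j (a b : 'X_{1..n < (k - hdeg (h j)).+1}), loc_entry (h j) y a b = 0) ->
  inIk h k r -> riesz y r = 0.
Proof.
move=> hy [psi [psi_deg ->]]; rewrite linear_sum big1 // => j _ /=.
rewrite [psi j]mpolyE big_distrl linear_sum big_seq big1 // => c c_psi /=.
have [a [b ->]] : exists a b : 'X_{1..n < (k - hdeg (h j)).+1}, c = (a + b)%MM.
  (* [msize] exceeds the degree by one, which matches the successor in the bound on [psi]. *)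
  by apply: mnm_split_half; rewrite -ltnS (leq_trans (msize_mdeg_lt c_psi)).
by rewrite -scalerAl linearZ /= -loc_entry_riesz hy mulr0.
Qed.

Lemma inIkZ {R : realType} {n l : nat} (h : 'I_l -> {mpoly R[n]}) (k : nat)
    (t : R) (r : {mpoly R[n]}) :
  inIk h k r -> inIk h k (t *: r).
Proof.
move=> [psi [psi_deg ->]]; exists (fun j => t *: psi j); split=> [j|].
  exact: leq_trans (msizeZ_le _ _) (psi_deg j).
by rewrite scaler_sumr; apply: eq_bigr => j _; rewrite scalerAl.
Qed.

Lemma inIk0 {R : realType} {n l : nat} (h : 'I_l -> {mpoly R[n]}) (k : nat) :
  inIk h k 0.
Proof.
exists (fun=> 0); split=> [j|]; first by rewrite msize0.
by rewrite big1 // => j _; rewrite mul0r.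
Qed.

(** * Weighted Gram polynomials and the interior of the quadratic module *)

(* The index None carries the unweighted block g_0 = 1, as in blk. *)
Definition weight {R : realType} {n m : nat} (g : 'I_m -> {mpoly R[n]})
  (i : option 'I_m) : {mpoly R[n]} := if i is Some i' then g i' else 1.

Definition weighted_gram {R : realType} {n m : nat} {g : 'I_m -> {mpoly R[n]}}
    {k : nat}
    (A : forall i, 'X_{1..n < blk_bound g k i} -> 'X_{1..n < blk_bound g k i} -> R)
  : {mpoly R[n]} :=
  \sum_i \sum_a \sum_b A i a b *: ('X_[a + b] * weight g i).

Lemma weighted_gramE {R : realType} {n m : nat} (g : 'I_m -> {mpoly R[n]})
    (k : nat)
    (A : forall i, 'X_{1..n < blk_bound g k i} -> 'X_{1..n < blk_bound g k i} -> R) :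
  weighted_gram A = gram_poly (A None)
                    + \sum_(i < m) g i * @gram_poly R n _ (A (Some i)).
Proof.
rewrite /weighted_gram (bigD1 None) //=; congr (_ + _).
  by apply: eq_bigr => a _; apply: eq_bigr => b _; rewrite mulr1.
rewrite (reindex_omap Some id) /= => [|[i|]] //.
apply: eq_big => [i|i _]; first by rewrite eqxx.
rewrite /gram_poly big_distrr; apply: eq_bigr => a _ /=.
by rewrite big_distrr; apply: eq_bigr => b _ /=; rewrite -scalerAr mulrC.
Qed.

(** Merges [G0] and the [G i] into one family over [option 'I_m], the index set of the blocks of
    [S_k]. *)
Lemma inQintP {R : realType} {n m : nat} (g : 'I_m -> {mpoly R[n]}) (k : nat)
    (p : {mpoly R[n]}) :
  inQint g k p <-> exists A : forall i,
      'X_{1..n < blk_bound g k i} -> 'X_{1..n < blk_bound g k i} -> R,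
    (forall i, symPD (A i)) /\ p = weighted_gram A.
Proof.
split=> [[G0 [G [G0pd [Gpd ->]]]]|[A [Apd ->]]].
  exists (fun i => match i return 'X_{1..n < blk_bound g k i} ->
                                  'X_{1..n < blk_bound g k i} -> R with
                   | Some i' => G i' | None => G0 end).
  split; last by rewrite weighted_gramE.
  by case=> [i|]; [exact: Gpd|].
exists (A None), (fun i => A (Some i)); rewrite weighted_gramE.
by split; [exact: (Apd None)|split=> // i; exact: (Apd (Some i))].
Qed.

Lemma inQintZ {R : realType} {n m : nat} (g : 'I_m -> {mpoly R[n]}) (k : nat)
    (t : R) (p : {mpoly R[n]}) :
  0 < t -> inQint g k p -> inQint g k (t *: p).
Proof.
move=> t0 /inQintP[A [Apd ->]]; apply/inQintP; exists (fun i a b => t * A i a b).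
split=> [i|].
  split=> [a b|z z0]; first by rewrite (Apd i).1.
  have := (Apd i).2 z z0; rewrite -(pmulr_rgt0 _ t0) big_distrr /=.
  congr (0 < _); apply: eq_bigr => a _; rewrite big_distrr; apply: eq_bigr => b _.
  by rewrite /= !mulrA (mulrC t).
rewrite /weighted_gram scaler_sumr; apply: eq_bigr => i _.
rewrite scaler_sumr; apply: eq_bigr => a _.
by rewrite scaler_sumr; apply: eq_bigr => b _; rewrite scalerA.
Qed.

Lemma inQI_scale {R : realType} {n m l : nat} (g : 'I_m -> {mpoly R[n]})
    (h : 'I_l -> {mpoly R[n]}) (k : nat) (t : R) (p : {mpoly R[n]}) :
  0 < t -> inQI g h k p -> inQI g h k (t *: p).
Proof.
move=> t0 [q [r [q_in [r_in ->]]]]; exists (t *: q), (t *: r).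
by rewrite scalerDr; split; [exact: inQintZ|split=> //; exact: inIkZ].
Qed.

(** The set is stable under positive scaling, so it contains 1 exactly when it contains every
    positive constant. *)
Lemma inQI1 {R : realType} {n m l : nat} (g : 'I_m -> {mpoly R[n]})
    (h : 'I_l -> {mpoly R[n]}) (k : nat) :
  (forall delta : R, 0 < delta -> inQI g h k delta%:MP) <-> inQI g h k 1.
Proof.
split=> [/(_ 1 ltr01) //|h1 delta delta0].
by rewrite -alg_mpolyC; apply: inQI_scale.
Qed.

(** * The trace as a Riesz functional, and the constant trace property *)

Lemma Dk_riesz {R : realType} {n m : nat} (g : 'I_m -> {mpoly R[n]}) (k : nat)
    (y : 'X_{1..n} -> R) :
  @Dk R n m g k y =2
  block_sum (fun i (a b : 'X_{1..n < blk_bound g k i}) =>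
               riesz y ('X_[a + b] * weight g i)).
Proof.
move=> [i a] [j b]; rewrite /Dk /block_sum /=; have [ij|//] := eqVneq i j.
case: j / ij b => b; rewrite tagged_asE.
by case: i a b => [i|] a b /=; rewrite ?loc_entry_riesz // mulr1 rieszX.
Qed.

(** By symmetry of [D = D_k(y)], the trace is the sum of [(P^2)_(w,v) D_(w,v)]. Since [D] is block
    diagonal, only the diagonal blocks of [P^2] enter. *)
Lemma trPDP_riesz {R : realType} {n m : nat} (g : 'I_m -> {mpoly R[n]}) (k : nat)
    (y : 'X_{1..n} -> R) (P : blk g k -> blk g k -> R) :
  trPDP P (@Dk R n m g k y) = riesz y (weighted_gram (fun i a b =>
    \sum_u P (Tagged _ a) u * P u (Tagged _ b))).
Proof.
have D_sym u v : @Dk R n m g k y u v = @Dk R n m g k y v u.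
  rewrite !Dk_riesz; case: u v => [i a] [j b].
  have [ij|ij] := eqVneq i j; last by rewrite !block_sum_off // eq_sym.
  by case: j / ij b => b; rewrite !block_sum_diag addmC.
rewrite /trPDP; transitivity (\sum_w \sum_v (\sum_u P w u * P u v) *
    @Dk R n m g k y w v).
  rewrite [LHS]exchange_big [RHS]exchange_big.
  apply: eq_bigr => v _ /=; rewrite exchange_big; apply: eq_bigr => w _ /=.
  rewrite big_distrl; apply: eq_bigr => u _ /=.
  by rewrite (D_sym v) mulrC mulrA.
under eq_bigr => w _ do under eq_bigr => v _ do rewrite Dk_riesz.
rewrite sum_block_sum linear_sum; apply: eq_bigr => i _ /=.
rewrite linear_sum; apply: eq_bigr => a _ /=.
by rewrite linear_sum; apply: eq_bigr => b _; rewrite linearZ.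
Qed.

Lemma inQI_CTP {R : realType} {n m l : nat} (f : {mpoly R[n]})
    (g : 'I_m -> {mpoly R[n]}) (h : 'I_l -> {mpoly R[n]}) :
  (forall k : nat, (kmin f g h <= k)%N -> inQI g h k 1) -> CTP f g h.
Proof.
move=> h1 k /h1[q [r [/inQintP[A [Apd qA]] [r_in qr]]]].
have /fin_all_exists[B BP] i := symPD_sqrt (Apd i).
exists 1; split=> //; exists (block_sum B); split=> [u v uv|].
  exact: block_sum_off.
split; first by apply: symPD_block_sum => i; case: (BP i).
move=> y hy y0; rewrite trPDP_riesz.
(* The diagonal blocks of the square of [block_sum B] are the [A i], so this polynomial is [q]. *)
suff -> : weighted_gram (fun i a b => \sum_u
    block_sum B (Tagged _ a) u * block_sum B u (Tagged _ b)) = 1 - r.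
  by rewrite linearB /= riesz1 (riesz_inIk hy r_in) subr0.
rewrite qr addrK qA; apply: eq_bigr => i _; apply: eq_bigr => a _.
by apply: eq_bigr => b _; rewrite block_sum_sqr (BP i).2.
Qed.

Lemma riesz_const {R : realType} {n : nat} (p : {mpoly R[n]}) (t : R) :
  (forall y : 'X_{1..n} -> R, y 0%MM = 1 -> riesz y p = t) -> p = t%:MP.
Proof.
move=> py; have p0 : p@_0 = t.
  (* The indicator of the exponent 0 is a moment sequence whose functional reads off the constant
     coefficient. *)
  rewrite -(py (fun d => (0%MM == d)%:R)) ?eqxx //.
  rewrite {1}[p]mpolyE raddf_sum /=; apply: eq_bigr => d _.
  by rewrite mcoeffZ mcoeffX eq_sym.
apply/mpolyP => c; rewrite mcoeffC; have [->|c0] := eqVneq c 0%MM.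
  by rewrite mulr1.
rewrite mulr0; apply: (addrI t); rewrite addr0 -{1}p0.
(* Two moment sequences with y_0 = 1 that differ only at c have Riesz
   functionals that differ by the coefficient of x^c. *)
rewrite -(py (fun d => (0%MM == d)%:R + (c == d)%:R)); last first.
  by rewrite eqxx (negPf c0) addr0.
rewrite {1 2}[p]mpolyE !raddf_sum -big_split; apply: eq_bigr => d _ /=.
by rewrite !mcoeffZ !mcoeffX !(eq_sym d) mulrDr.
Qed.

Lemma CTP_inQint {R : realType} {n m : nat} {f : {mpoly R[n]}}
    {g : 'I_m -> {mpoly R[n]}} {h : 'I_0 -> {mpoly R[n]}} {k : nat} :
  CTP f g h -> (kmin f g h <= k)%N -> inQint g k 1.
Proof.
move=> /[apply] -[t [t0 [P [_ [Ppd tr]]]]].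
have -> : 1 = t^-1 *: t%:MP :> {mpoly R[n]}.
  by rewrite -mul_mpolyC -mpolyCM mulVf ?gt_eqF.
apply: inQintZ; rewrite ?invr_gt0 //; apply/inQintP.
(* The diagonal blocks of [P^2] are principal submatrices of a positive definite matrix. *)
exists (fun i a b => \sum_u P (Tagged _ a) u * P u (Tagged _ b)); split=> [i|].
  by apply: symPD_restrict (symPD_sqr Ppd) => a b /eqP; rewrite eq_Tagged => /eqP.
(* With ['I_0] indexing the equality constraints, the trace identity holds for every [y] with
   [y_0 = 1]. *)
by apply/esym/riesz_const => y y0; rewrite -trPDP_riesz tr // => -[].
Qed.

Theorem theorem1 :
  (forall (R : realType) (n m l : nat) (f : {mpoly R[n]})
          (g : 'I_m -> {mpoly R[n]}) (h : 'I_l -> {mpoly R[n]}),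
     (forall k : nat, (kmin f g h <= k)%N ->
        ((forall delta : R, delta \in `]0, +oo[ -> inQI g h k delta%:MP) <->
         (forall delta : R, 0 < delta -> inQI g h k delta%:MP)) /\
        ((forall delta : R, 0 < delta -> inQI g h k delta%:MP) <->
         inQI g h k 1)) /\
     ((forall k : nat, (kmin f g h <= k)%N ->
        forall delta : R, 0 < delta -> inQI g h k delta%:MP) ->
      CTP f g h)) /\
  (forall (R : realType) (n m : nat) (f : {mpoly R[n]})
          (g : 'I_m -> {mpoly R[n]}) (h : 'I_0 -> {mpoly R[n]}),
     S_nonempty_interior g ->
     (CTP f g h <->
      forall k : nat, (kmin f g h <= k)%N ->
        forall delta : R, delta \in `]0, +oo[ -> inQint g k delta%:MP)).
Proof.
split=> [R n m l f g h|R n m f g h _].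
  split=> [k _|h1]; last by apply: inQI_CTP => k kk; apply/inQI1/h1.
  split; last exact: inQI1.
  by split=> h1 delta; have := h1 delta; rewrite in_itv /= andbT.
split=> [ctp k kk delta|h1].
  rewrite in_itv /= andbT -alg_mpolyC => delta0.
  exact/inQintZ/(CTP_inQint ctp).
(* The decomposition is [1 = 1 + 0]: the first summand comes from [delta = 1], and the second lies
   in the zero ideal. *)
apply: inQI_CTP => k kk; exists 1, 0; rewrite addr0.
by split; [apply: h1; rewrite // in_itv /= ltr01|split=> //; exact: inIk0].
Qed.
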